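(* The $C(\lambda)$-typical function maps a set of Lebesgue measure zero onto $[0,1]$; that is, there is a dense $G_\delta$ subset $G$ of the metric space $(C(\lambda),\rho)$ such that for every $f\in G$ there is a set $Z\subset[0,1]$ with $\lambda(Z)=0$ and $f(Z)=[0,1]$.
   Context: $\lambda$ is the Lebesgue measure on $[0,1]$, $\mathcal B$ the Borel $\sigma$-algebra of $[0,1]$. $C(\lambda)$ is the set of all continuous maps $f\colon[0,1]\to[0,1]$ with $\lambda(A)=\lambda(f^{-1}(A))$ for all $A\in\mathcal B$, equipped with the complete metric $\rho(f,g)=\sup_{x\in[0,1]}|f(x)-g(x)|$. *)

(* Defs.v *)
From HB Require Import structures.
From mathcomp Require Import all_boot all_order all_algebra.
From mathcomp Require Import all_classical all_reals all_analysis.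
From mathcomp Require Import lra.

Set Implicit Arguments.
Unset Strict Implicit.
Unset Printing Implicit Defensive.

Import Order.TTheory GRing.Theory Num.Theory.
Import numFieldNormedType.Exports.

Local Open Scope classical_set_scope.
Local Open Scope ring_scope.

(* As a [set_type], the unit interval carries the topology (and the uniform
   structure) induced by the real line. *)
Definition I01 (R : realType) : Type := set_type (`[0, 1]%classic : set R).

HB.instance Definition _ (R : realType) := PseudoMetric.on (I01 R).

Section Clambda.
Context {R : realType}.

Definition borelI01 : set (set (I01 R)) := <<s [set U : set (I01 R) | open U] >>.

(* [lebesgue_measure] is the Caratheodory extension of the length of intervals,
   given by its outer measure on every set of reals. Hence [lambda] is Lebesgue
   measure on the Borel (and Lebesgue measurable) subsets of [0, 1], and
   [lambda Z = 0] says that [Z] is Lebesgue null, see [lambda_eq0]. *)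
Definition lambda (A : set (I01 R)) : \bar R :=
  lebesgue_measure (set_val @` A : set R).

Lemma lambda_eq0 (Z : set (I01 R)) :
  lambda Z = 0%E <->
  (@lebesgue_measure R).-negligible (set_val @` Z : set R).
Proof. by symmetry; exact: negligible_outer_measure. Qed.

Definition preserves_lambda (f : I01 R -> I01 R) :=
  forall A, borelI01 A -> lambda A = lambda (f @^-1` A).

End Clambda.

Record Clambda (R : realType) := MkClambda {
  Clambda_fun :> I01 R -> I01 R;
  Clambda_continuous : continuous Clambda_fun;
  Clambda_preserves : preserves_lambda Clambda_fun }.

HB.instance Definition _ (R : realType) := gen_eqMixin (Clambda R).
HB.instance Definition _ (R : realType) := gen_choiceMixin (Clambda R).

Section rho.
Context {R : realType}.
Implicit Types f g h : Clambda R.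

Definition rho f g : R :=
  sup [set `|set_val (f x) - set_val (g x)| | x in [set: I01 R]].

Lemma Clambda_ext f g : f =1 g -> f = g.
Proof.
case: f g => [f cf pf] [g cg pg] /= /funext fg.
by subst g; congr MkClambda; exact: Prop_irrelevance.
Qed.

Lemma I01_dist_le1 (x y : I01 R) : `|set_val x - set_val y| <= 1 :> R.
Proof.
have b (z : I01 R) : 0 <= (set_val z : R) <= 1.
  by have /set_mem := valP z; rewrite /= in_itv.
have /andP[x0 x1] := b x; have /andP[y0 y1] := b y.
by rewrite ler_norml; apply/andP; split; lra.
Qed.

Lemma I01_inh : I01 R.
Proof. by exists 0; rewrite inE/= in_itv/= lexx ler01. Qed.

Lemma rho_has_sup f g :
  has_sup [set `|set_val (f x) - set_val (g x) : R| | x in [set: I01 R]].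
Proof.
split; first by exists (`|set_val (f I01_inh) - set_val (g I01_inh)|), I01_inh.
by exists 1 => _ [x _ <-]; exact: I01_dist_le1.
Qed.

Lemma rho_ub f g x : `|set_val (f x) - set_val (g x)| <= rho f g.
Proof. by apply: ub_le_sup; [exact: (rho_has_sup f g).2 | exists x]. Qed.

Lemma rho_le f g (e : R) :
  (forall x, `|set_val (f x) - set_val (g x)| <= e) -> rho f g <= e.
Proof.
by move=> fge; apply: ge_sup; [exact: (rho_has_sup f g).1 | move=> _ [x _ <-]].
Qed.

Lemma rhoxx f : rho f f = 0.
Proof.
apply/eqP; rewrite eq_le; apply/andP; split.
  by apply: rho_le => x; rewrite subrr normr0.
exact: le_trans (normr_ge0 _) (rho_ub f f I01_inh).
Qed.

Lemma rho_positivity f g : rho f g = 0 -> f = g.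
Proof.
move=> fg0; apply: Clambda_ext => x; apply: val_inj; apply/eqP.
rewrite -subr_eq0 -normr_le0; apply: le_trans (rho_ub f g x) _.
by rewrite fg0.
Qed.

Lemma rho_sym f g : rho f g = rho g f.
Proof. by apply/eqP; rewrite eq_le; apply/andP; split; apply: rho_le => x;
  rewrite distrC; exact: rho_ub. Qed.

Lemma rho_triangle g f h : rho f h <= rho f g + rho g h.
Proof.
apply: rho_le => x; rewrite (le_trans (ler_distD (set_val (g x)) _ _))//.
by rewrite lerD// rho_ub.
Qed.

End rho.

HB.instance Definition _ (R : realType) := @isMetric.Build R (Clambda R)
  rho rhoxx rho_positivity rho_sym rho_triangle.

(* Main.v *)
Require Import Defs.
From mathcomp Require Import all_boot all_order all_algebra.
From mathcomp Require Import all_classical all_reals all_analysis.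
From mathcomp Require Import borel_hierarchy.
From mathcomp Require Import measurable_realfun lra zify.

(** Given [f] in C(lambda), cut [0, 1] into [N] equal windows and let [phi] map
    each window onto itself by a zigzag with [3 ^ k] affine laps. Such a [phi] preserves lambda and moves no point by
    more than [1 / N], so [f \o phi] belongs to C(lambda) and, [f] being
    uniformly continuous, is close to [f] when [N] is large. On the other hand
    a single lap, of length [1 / (N * 3 ^ k)], is already mapped onto its
    window: the joint made of the last lap of a window and the first lap of the
    next one carries all the values of [f] on the two windows, although the
    joints have total measure of order [3 ^ - k].

    The typical set is the intersection over [n] of the open sets [crumpled n]
    of all maps within [1 / (3 N)] of such an [f \o phi], with [N > n] and
    [k >= n]. Each is dense by the above ([dense_crumpled]), and C(lambda) is a
    complete metric space, hence a Baire space ([Clambda_Baire]).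

    Let [h] be in this intersection, and say that [h] straddles [t] on an
    interval if it takes there a value below [t] and a value above [t]. The
    heart of the proof is [straddle_junction]: if [h] straddles [t] on an
    interval, then it straddles [t] on some arbitrarily small joint inside that
    interval. Indeed the image of a window under [f] cannot be contained in a
    ball of radius [1 / (3 N)], because [f] preserves lambda and the window has
    measure [1 / N]; so on each window [f] has a value clearly below [t] or one
    clearly above [t], and somewhere between the two given points a window of
    the first kind is adjacent to one of the second kind. Their common joint
    inherits both values.

    For [0 < t < 1], iterating gives nested joints, of level tending to
    infinity, that shrink to a point [x] with [h x = t] ([nested_straddles]).
    That point lies in infinitely many of the sets [joints], whose measures are
    summable; by Borel-Cantelli the set of all such points is null. Adding one
    preimage of [0] and one of [1] gives the required null set. *)

Set Implicit Arguments.
Unset Strict Implicit.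
Unset Printing Implicit Defensive.

Import Order.TTheory GRing.Theory Num.Theory.
Import numFieldNormedType.Exports.

Local Open Scope classical_set_scope.
Local Open Scope ring_scope.

(** * Coordinates on the unit interval *)

Section unit_interval.
Context {R : realType}.
Implicit Types (x : I01 R) (t : R) (f : I01 R -> I01 R).

Lemma I01_itv x : 0 <= (set_val x : R) <= 1.
Proof. by have /set_mem := valP x; rewrite /= in_itv. Qed.

Lemma clamp_subproof t : Num.max 0 (Num.min t 1) \in (`[0, 1]%classic : set R).
Proof.
by rewrite inE /= in_itv /= le_max lexx /= ge_max ler01 /= ge_min lexx orbT.
Qed.

(** The retraction of the real line onto [0, 1]. Through it a self-map [f] of
    [I01 R] becomes the function [set_val \o f \o clamp] on the whole real line,
    to which the theorems on real functions apply. *)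
Definition clamp t : I01 R :=
  exist (fun t => t \in `[0, 1]%classic) _ (clamp_subproof t).

Lemma val_clamp t : 0 <= t <= 1 -> set_val (clamp t) = t.
Proof. by move=> /andP[t0 t1]; rewrite set_valE /= min_l// max_r. Qed.

Lemma clampK x : clamp (set_val x) = x.
Proof. by apply: val_inj; exact: val_clamp (I01_itv x). Qed.

Lemma continuous_val : continuous (set_val : I01 R -> R).
Proof. exact: initial_continuous. Qed.

Lemma I01_continuous (T : topologicalType) (h : T -> I01 R) :
  continuous (set_val \o h : T -> R) -> continuous h.
Proof. exact: continuous_comp_initial. Qed.

Lemma continuous_clamp : continuous clamp.
Proof.
apply: I01_continuous => t.
apply: (@continuous_max R R (cst 0) (fun t => Num.min t 1)); first exact: cvg_cst.
by apply: (@continuous_min R R id (cst 1)); [exact: cvg_id|exact: cvg_cst].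
Qed.

Lemma continuous_real_extension f :
  continuous f -> continuous (set_val \o f \o clamp : R -> R).
Proof.
move=> cf t; apply: (@continuous_comp _ _ _ clamp); first exact: continuous_clamp.
by apply: continuous_comp; [exact: cf|exact: continuous_val].
Qed.

End unit_interval.

(** * Measure-preserving maps of the unit interval *)

Section lambda_theory.
Context {R : realType}.
Implicit Types (x : I01 R) (c : R) (f : I01 R -> I01 R).
Local Notation mu := (@lebesgue_measure R).

Lemma lambda_preimage_val (B : set R) :
  lambda (set_val @^-1` B : set (I01 R)) = mu (B `&` `[0, 1]).
Proof.
congr (mu _); apply/seteqP; split => [_ [x Bx <-]|t [Bt]].
  by split => //=; rewrite in_itv; exact: I01_itv.
by rewrite /= in_itv /= => t01; exists (clamp t); rewrite /= val_clamp.
Qed.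

Lemma lambda_ray c : 0 <= c <= 1 ->
  lambda [set x : I01 R | set_val x < c] = c%:E.
Proof.
move=> /andP[c0 c1]; rewrite (lambda_preimage_val `]-oo, c[%classic).
have -> : `]-oo, c[ `&` `[0, 1] = `[0, c[%classic :> set R.
  apply/seteqP; split => t /=; rewrite !in_itv /=; first by case=> -> /andP[->].
  by move=> /andP[-> tc]; rewrite tc; split=> //; rewrite ltW// (lt_le_trans tc).
rewrite lebesgue_measure_itv /= lte_fin; case: ltgtP c0 => // [c0 _|<-//].
by rewrite oppr0 adde0.
Qed.

(** The topology of [I01 R] is induced by the real line, hence so are its Borel
    sets: this and the next lemma let measures on the real line decide. *)
Lemma borelI01_preimage (A : set (I01 R)) : borelI01 A ->
  exists2 B : set R, measurable B & A = set_val @^-1` B.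
Proof.
move: A; apply: (@smallest_sub _ (sigma_algebra setT) _
  [set A | exists2 B : set R, measurable B & A = set_val @^-1` B]);
  last first.
  move=> _ /= [B oB <-].
  by exists B => //; exact: open_measurable.
split => /=.
- by exists set0; rewrite ?preimage_set0.
- move=> _ [B mB ->]; exists (~` B); first exact: measurableC.
  by rewrite setTD preimage_setC.
- move=> F FB; have /choice[B /all_and2[mB FE]] : forall n, exists B : set R,
      measurable B /\ F n = set_val @^-1` B.
    by move=> n; have [B mB FE] := FB n; exists B.
  exists (\bigcup_n B n); first exact: bigcupT_measurable.
  by rewrite preimage_bigcup; apply: eq_bigcupr => n _.
Qed.

Lemma borelI01_preimage_val (B : set R) : measurable B ->
  borelI01 (set_val @^-1` B : set (I01 R)).
Proof.
have sI : sigma_algebra setT (@borelI01 R) by exact: smallest_sigma_algebra.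
move=> mB; have : (@RGenOpens.G R).-sigma.-measurable B.
  by rewrite -RGenOpens.measurableE.
move: B {mB}; apply: (@smallest_sub _ (sigma_algebra setT)
  _ [set B | borelI01 (set_val @^-1` B)]); last first.
  move=> _ [a [b ->]]; apply: sub_sigma_algebra => /=.
  by move/continuousP : (@continuous_val R); apply; exact: interval_open.
have [s0 sC sU] := sI; split => /=.
- by rewrite preimage_set0.
- by move=> B sB; rewrite setTD preimage_setC -setTD; exact: sC.
- by move=> F sF; rewrite preimage_bigcup; exact: sU.
Qed.

(** Both sides of the preservation identity are traces of finite measures on
    the real line, and the open rays form a pi-system generating the Borel
    sets. This is the criterion by which zigzags and uniform limits are shown
    to preserve lambda. *)
Lemma preserves_lambdaP f : continuous f ->
  (forall c, 0 <= c <= 1 -> lambda [set x | set_val (f x) < c] = c%:E) ->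
  preserves_lambda f.
Proof.
move=> cf fray A /borelI01_preimage[B mB ->].
pose F := set_val \o f \o clamp : R -> R.
have cF : continuous F by exact: continuous_real_extension.
have mF : measurable_fun setT (F : measurableTypeR R -> measurableTypeR R).
  exact: continuous_measurable_fun.
have mI : measurable (`[0, 1]%classic : set (measurableTypeR R)).
  exact: measurable_itv.
have preimE C : lambda (f @^-1` (set_val @^-1` C)) = mu (F @^-1` C `&` `[0, 1]).
  rewrite -lambda_preimage_val; congr lambda.
  by apply/seteqP; split => x /=; rewrite /F /= clampK.
rewrite preimE lambda_preimage_val.
pose m1 : {measure set (measurableTypeR R) -> \bar R} := mrestr mu mI.
have [m2 m2E] : exists m2 : {measure set (measurableTypeR R) -> \bar R},
    forall C, m2 C = m1 (F @^-1` C).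
  by unshelve eexists [the measure _ _ of
    pushforward m1 (F : measurableTypeR R -> measurableTypeR R)].
(* [m1] is Lebesgue measure on [0, 1] and [m2] its image under [F]. *)
rewrite -[LHS]/(m1 B) -[RHS]/(m1 (F @^-1` B)) -m2E.
apply: (@measure_unique _ R (measurableTypeR R) (@RGenInftyO.G R)
  (fun k => `]-oo, k%:R[%classic) _ _ _ _ m1 m2).
- exact: RGenInftyO.measurableE.
- move=> _ _ [a ->] [b ->]; exists (Num.min a b).
  by apply/seteqP; split => t /=; rewrite !in_itv /= lt_min => /andP.
- by move=> k; exists k%:R.
- rewrite -subTset => t _; exists (Num.truncn t).+1 => //=.
  by rewrite in_itv /= truncnS_gt.
- move=> _ [c ->]; rewrite m2E.
  rewrite -[LHS]/(mu (`]-oo, c[ `&` `[0, 1])) -lambda_preimage_val.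
  rewrite -[RHS]/(mu (F @^-1` `]-oo, c[ `&` `[0, 1])) -preimE.
  have [c0|c0] := ltP c 0.
    congr lambda; apply/seteqP; split => x; rewrite /= in_itv /= => xc; exfalso.
      by have /andP[+ _] := I01_itv x; lra.
    by have /andP[+ _] := I01_itv (f x); lra.
  have [c1|c1] := leP c 1.
    transitivity c%:E; first by rewrite -lambda_ray ?c0.
    by rewrite -[LHS]fray ?c0.
  congr lambda; apply/seteqP; split => x; rewrite /= in_itv /= => _.
    by rewrite in_itv /= (le_lt_trans _ c1)//; case/andP: (I01_itv (f x)).
  by rewrite in_itv /= (le_lt_trans _ c1)//; case/andP: (I01_itv x).
- move=> k; rewrite (@le_lt_trans _ _ (mu `[0, 1]%classic))//.
    by apply: le_measure; rewrite ?inE //=; exact: measurableI.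
  by rewrite lebesgue_measure_itv /= lte_fin ltr01 -EFinB ltry.
- exact: mB.
Qed.

Lemma le_lambda (A B : set (I01 R)) : A `<=` B -> (lambda A <= lambda B)%E.
Proof. by move=> AB; apply: le_outer_measure; exact: image_subset. Qed.

Lemma lambda_setT : lambda [set: I01 R] = 1%E.
Proof.
rewrite -(preimage_setT (set_val : I01 R -> R)) lambda_preimage_val setTI.
by rewrite lebesgue_measure_itv /= lte_fin ltr01 oppr0 adde0.
Qed.

Lemma lambda_le1 (A : set (I01 R)) : (lambda A <= 1)%E.
Proof. by rewrite -lambda_setT; exact: le_lambda. Qed.

Lemma lambda_ge0 (A : set (I01 R)) : (0 <= lambda A)%E.
Proof. exact: outer_measure_ge0. Qed.

End lambda_theory.

(** * The zigzag with three laps *)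

Section zigzag.
Context {R : realType}.
Implicit Types a b c t : R.

(** The broken line through [(a, a)], [(a + (b - a) / 3, b)],
    [(b - (b - a) / 3, a)] and [(b, b)], with its first and last pieces extended
    to half-lines. *)
Definition three_laps a b t : R :=
  Num.max (Num.min (3 * t - 2 * a) (2 * (a + b) - 3 * t)) (3 * t - 2 * b).

(** The broken line on [a, b], continued by the identity. Only minima and maxima
    of affine functions occur, so that continuity is immediate and all order
    facts reduce to linear arithmetic. *)
Definition zigzag a b t : R :=
  Num.min (Num.max (three_laps a b t) (Num.min t a)) (Num.max t b).

(** The preimage of a ray ending inside [a, b] is a ray and an interval, one
    piece from the first lap and one from the other two. When
    [0 <= a], their parts right of [0] have total length [c], as that of the
    ray itself. *)
Lemma zigzag_lt a b c t : a < b ->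
  (zigzag a b t < c) =
  if a < c <= b then (t < (c + 2 * a) / 3) ||
     ((2 * (a + b) - c) / 3 < t < (c + 2 * b) / 3)
  else t < c.
Proof.
move=> ab; rewrite /zigzag /three_laps !(gt_min, gt_max).
by case: ifPn => h; apply/idP/idP; lra.
Qed.

Lemma zigzag_out a b t : a < b -> t <= a \/ b <= t -> zigzag a b t = t.
Proof.
move=> ab h; apply/eqP; rewrite eq_le /zigzag /three_laps !(ge_min, ge_max, le_min, le_max).
lra.
Qed.

Lemma zigzag_in a b t : a <= t <= b -> a <= zigzag a b t <= b.
Proof. rewrite /zigzag /three_laps !(ge_min, ge_max, le_min, le_max); lra. Qed.

Lemma zigzag_first a b t : 0 <= t <= (b - a) / 3 -> zigzag a b (a + t) = a + 3 * t.
Proof.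
move=> h; apply/eqP; rewrite eq_le /zigzag /three_laps !(ge_min, ge_max, le_min, le_max).
lra.
Qed.

Lemma zigzag_last a b t : 0 <= t <= (b - a) / 3 -> zigzag a b (b - t) = b - 3 * t.
Proof.
move=> h; apply/eqP; rewrite eq_le /zigzag /three_laps !(ge_min, ge_max, le_min, le_max).
lra.
Qed.

Lemma continuous_zigzag a b : continuous (zigzag a b).
Proof.
move=> t; have lin u v : {for t, continuous (fun t : R => u * t - v)}.
  by apply: cvgB; [apply: cvgM; [exact: cvg_cst|exact: cvg_id]|exact: cvg_cst].
have lin' u v : {for t, continuous (fun t : R => v - u * t)}.
  by apply: cvgB; [exact: cvg_cst|apply: cvgM; [exact: cvg_cst|exact: cvg_id]].
rewrite -[zigzag a b]/((((fun t => 3 * t - 2 * a) \min (fun t => 2 * (a + b) - 3 * t)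
  \max (fun t => 3 * t - 2 * b)) \max (id \min cst a)) \min (id \max cst b)).
by do !(first [apply: continuous_min|apply: continuous_max]);
  rewrite //; first [exact: cvg_id|exact: cvg_cst].
Qed.

Lemma zigzag_Clambda a b : 0 <= a -> a < b -> b <= 1 ->
  exists phi : Clambda R, forall x, set_val (phi x) = zigzag a b (set_val x).
Proof.
move=> a0 ab b1.
have zz01 t : 0 <= t <= 1 -> 0 <= zigzag a b t <= 1.
  by rewrite /zigzag /three_laps !(ge_min, ge_max, le_min, le_max); lra.
pose f (x : I01 R) := clamp (zigzag a b (set_val x)).
have fE x : set_val (f x) = zigzag a b (set_val x).
  by apply: val_clamp; exact: zz01 (I01_itv x).
have cf : continuous f.
  move=> x; apply: (@continuous_comp (I01 R) R (I01 R)
    (zigzag a b \o set_val) clamp); last exact: continuous_clamp.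
  by apply: continuous_comp; [exact: continuous_val|exact: continuous_zigzag].
suff pf : preserves_lambda f by exists (MkClambda cf pf).
apply: preserves_lambdaP => // c c01.
have [/andP[ac cb]|acb] := boolP (a < c <= b); last first.
  rewrite -[RHS]lambda_ray//; congr lambda; apply/seteqP.
  by split=> x /=; rewrite fE zigzag_lt// (negbTE acb).
pose A := `[0, (c + 2 * a) / 3[%classic : set R.
pose B := `](2 * (a + b) - c) / 3, (c + 2 * b) / 3[%classic : set R.
transitivity (lebesgue_measure (A `|` B)).
  transitivity (lambda (set_val @^-1` (A `|` B) : set (I01 R))).
    congr lambda; apply/seteqP; split=> x /=; rewrite fE zigzag_lt// ac cb /=;
      have := I01_itv x; rewrite /A /B /= !in_itv /=.
      by move=> /andP[-> _] /orP.
    by move=> _ [/andP[_ ->]//|->]; rewrite orbT.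
  rewrite lambda_preimage_val setIidl// => t; rewrite /A /B /= !in_itv /=; lra.
transitivity (lebesgue_measure A + lebesgue_measure B)%E.
  apply: measureU; [exact: measurable_itv|exact: measurable_itv|].
  by apply/seteqP; split => // t; rewrite /A /B /= !in_itv /=; lra.
rewrite /A /B !lebesgue_measure_itv /= !lte_fin !ifT; [|lra|lra].
by rewrite -!EFinB -EFinD; congr EFin; lra.
Qed.

End zigzag.

(** * Zigzags on all the windows of a subdivision *)

Section crumple.
Context {R : realType}.
Implicit Types (x : I01 R) (f g phi : Clambda R).

Lemma borelI01_preimage_continuous (f : I01 R -> I01 R) (A : set (I01 R)) :
  continuous f -> borelI01 A -> borelI01 (f @^-1` A).
Proof.
move=> cf; have sI : sigma_algebra setT (@borelI01 R).
  exact: smallest_sigma_algebra.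
move: A; apply: (@smallest_sub _ (sigma_algebra setT) _
  [set A | borelI01 (f @^-1` A)]).
  have [s0 sC sU] := sI; split => /=.
  - by rewrite preimage_set0.
  - by move=> B sB; rewrite setTD preimage_setC -setTD; exact: sC.
  - by move=> F sF; rewrite preimage_bigcup; exact: sU.
by move=> U oU; apply: sub_sigma_algebra => /=; move/continuousP : cf; apply.
Qed.

Lemma Clambda_comp f g : exists h : Clambda R, h =1 f \o g.
Proof.
have cfg : continuous (f \o g).
  move=> x; apply: continuous_comp; exact: Clambda_continuous.
suff pfg : preserves_lambda (f \o g) by exists (MkClambda cfg pfg).
move=> A bA; rewrite (Clambda_preserves f bA) (Clambda_preserves g)//.
by apply: borelI01_preimage_continuous bA; exact: Clambda_continuous.
Qed.

Lemma Clambda_id : exists h : Clambda R, h =1 id.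
Proof.
suff pid : preserves_lambda (@id (I01 R)).
  by exists (MkClambda (fun x => cvg_id) pid).
by [].
Qed.

Lemma fracS (N i : nat) : i.+1%:R / N%:R = i%:R / N%:R + N%:R^-1 :> R.
Proof. by rewrite -natr1 mulrDl mul1r. Qed.

Lemma ler_frac (N i j : nat) : (i <= j)%N -> i%:R / N%:R <= j%:R / N%:R :> R.
Proof. by move=> ij; rewrite ler_wpM2r// ler_nat. Qed.

Definition window N i : set (I01 R) :=
  [set x | i%:R / N%:R <= (set_val x : R) <= i.+1%:R / N%:R].

(** The length of a lap of a zigzag with [3 ^ k] laps on a window. *)
Definition lap N k : R := (N%:R * 3 ^+ k)^-1.

(** The zigzags of the different windows are composed one after the other: each
    fixes the other windows pointwise and preserves its own. *)
Lemma zigzag_windows N : exists tau : Clambda R, forall i x, (i < N)%N ->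
  window N i x ->
  set_val (tau x) = zigzag (i%:R / N%:R) (i.+1%:R / N%:R) (set_val x).
Proof.
have [->|N0] := posnP N; first by have [h _] := Clambda_id; exists h.
have N0' : 0 < N%:R :> R by rewrite ltr0n.
have div_lt (i : nat) : i%:R / N%:R < i.+1%:R / N%:R :> R.
  by rewrite ltr_pM2r ?invr_gt0// ltr_nat.
suff : forall n, (n <= N)%N -> exists tau : Clambda R,
    forall i x, (i < N)%N -> window N i x -> set_val (tau x) =
    if (i < n)%N then zigzag (i%:R / N%:R) (i.+1%:R / N%:R) (set_val x)
    else set_val x.
  move=> /(_ N (leqnn N))[tau tauE]; exists tau => i x iN /tauE -> //.
  by rewrite iN.
elim=> [_|n IH nN].
  by have [h hE] := Clambda_id; exists h => i x _ _; rewrite hE.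
have [tau tauE] := IH (ltnW nN).
have [sg sgE] : exists sg : Clambda R,
    forall x, set_val (sg x) = zigzag (n%:R / N%:R) (n.+1%:R / N%:R) (set_val x).
  apply: zigzag_Clambda => //.
  by rewrite ler_pdivrMr// mul1r ler_nat.
have [h hE] := Clambda_comp sg tau.
exists h => i x iN wx; rewrite hE /= sgE (tauE i x iN wx) ltnS (leq_eqVlt i).
have [->|/eqP ni] := eqVneq i n; first by rewrite ltnn.
have [ni'|ni'] /= := ltnP i n; apply: zigzag_out => //.
  left; have /andP[_ /le_trans->//] := zigzag_in wx; exact: ler_frac.
right; move: wx => /andP[+ _]; apply: le_trans; apply: ler_frac; lia.
Qed.

(** Of the zigzag with [3 ^ k] laps on each window, only the behaviour at the
    inner ends of the first and last laps is recorded. With continuity, it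
    makes each of these two laps cover the whole window. *)
Definition crumples N k phi :=
  [/\ forall i x, (i < N)%N -> window N i x -> window N i (phi x),
      forall i x, (i < N)%N -> set_val x = i%:R / N%:R + lap N k ->
        set_val (phi x) = i.+1%:R / N%:R
    & forall i x, (i < N)%N -> set_val x = i.+1%:R / N%:R - lap N k ->
        set_val (phi x) = i%:R / N%:R].

Lemma lap_gt0 N k : (0 < N)%N -> 0 < lap N k.
Proof. by move=> N0; rewrite invr_gt0 mulr_gt0 ?exprn_gt0// ltr0n. Qed.

Lemma lapS N k : lap N k = 3 * lap N k.+1.
Proof.
by rewrite /lap exprS mulrCA [in RHS]invfM mulrA mulfV ?mul1r// pnatr_eq0.
Qed.

Lemma lap_le N k : (0 < N)%N -> lap N k <= N%:R^-1.
Proof.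
move=> N0; rewrite /lap invfM ler_piMr// invf_le1 ?exprn_gt0//.
by rewrite exprn_ege1// ler1n.
Qed.

(** One more zigzag with three laps on each window stretches a lap of level
    [k.+1] affinely onto a lap of level [k]. *)
Lemma exists_crumples N k : (0 < N)%N -> exists phi, crumples N k phi.
Proof.
move=> N0; have N0' : 0 < N%:R :> R by rewrite ltr0n.
elim: k => [|k [phi [phiW phiF phiL]]].
  have [h hE] := Clambda_id; exists h; rewrite /crumples /lap expr0 mulr1.
  split=> i x iN; rewrite hE// => ->.
    by rewrite fracS.
  by rewrite fracS addrK.
have [tau tauE] := zigzag_windows N; have [h hE] := Clambda_comp phi tau.
have l0 := lap_gt0 k.+1 N0; have l3 := lapS N k; have l1 := lap_le k N0.
exists h; split => i x iN.
- move=> wx; rewrite hE; apply: phiW => //; rewrite /window/= (tauE i)//.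
  exact: zigzag_in.
- move=> xE; rewrite hE; apply: phiF => //.
  by rewrite (tauE i) ?xE ?zigzag_first ?l3// /window/= ?xE fracS; lra.
- move=> xE; rewrite hE; apply: phiL => //.
  by rewrite (tauE i) ?xE ?zigzag_last ?l3// /window/= ?xE fracS; lra.
Qed.

End crumple.

(** * Completeness of C(lambda) and the Baire property *)

Section completeness.
Context {R : realType}.
Implicit Types (f g : Clambda R) (c : R).

Lemma lambda_ray_Clambda f c : 0 <= c <= 1 ->
  lambda [set x | set_val (f x) < c] = c%:E.
Proof.
move=> c01; rewrite -[RHS]lambda_ray//; symmetry.
apply: (Clambda_preserves f (A := [set x : I01 R | set_val x < c])).
by apply: (@borelI01_preimage_val _ `]-oo, c[%classic); exact: measurable_itv.
Qed.

(** Beyond either end of [0, 1] one of the two inequalities survives; the limit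
    argument below moves [c] slightly, possibly past an end. *)
Lemma lambda_ray_le f c : 0 <= c -> (lambda [set x | (set_val (f x) < c)%R] <= c%:E)%E.
Proof.
move=> c0; have [c1|c1] := leP c 1; first by rewrite lambda_ray_Clambda ?c0.
by rewrite (le_trans (lambda_le1 _))// lee_fin ltW.
Qed.

Lemma lambda_ray_ge f c : c <= 1 -> (c%:E <= lambda [set x | (set_val (f x) < c)%R])%E.
Proof.
move=> c1; have [c0|c0] := leP 0 c; first by rewrite lambda_ray_Clambda ?c0.
by rewrite (le_trans _ (lambda_ge0 _))// lee_fin ltW.
Qed.

(** Every [u n x - e n] is at most every [u m x + e m], so the supremum over [n]
    of the former is within [e n] of each [u n x]. This limit preserves
    lambda since the set where it is below [c] is squeezed between the sets
    where [u n] is below [c - d] and below [c + d]. *)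
Lemma Clambda_complete (u : nat -> Clambda R) (e : nat -> R) :
  (forall n m, (n <= m)%N -> rho (u n) (u m) <= e n) ->
  (forall d, 0 < d -> exists n, e n < d) ->
  exists l, forall n, rho (u n) l <= e n.
Proof.
move=> ue e0.
have en n : 0 <= e n by rewrite -(rhoxx (u n)) ue.
pose B x := [set (set_val (u n x) : R) - e n | n in [set: nat]].
have uu n m x : set_val (u n x) - e n <= set_val (u m x) + e m.
  have := en n; have := en m.
  have : `|set_val (u n x) - set_val (u m x)| <= Num.max (e n) (e m).
    rewrite le_max; have [nm|/ltnW mn] := leqP n m.
      by rewrite (le_trans (rho_ub _ _ _))// ue.
    by rewrite distrC orbC (le_trans (rho_ub _ _ _))// ue.
  rewrite le_max => /orP[]; rewrite ler_norml => /andP[]; lra.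
have Bsup x : has_sup (B x).
  split; first by exists (set_val (u 0%N x) - e 0%N), 0%N.
  by exists (set_val (u 0%N x) + e 0%N) => _ [n _ <-]; exact: uu.
pose L x := sup (B x).
have uL n x : `|set_val (u n x) - L x| <= e n.
  have h1 : set_val (u n x) - e n <= L x.
    by apply: ub_le_sup; [exact: (Bsup x).2|exists n].
  have h2 : L x <= set_val (u n x) + e n.
    by apply: ge_sup; [exact: (Bsup x).1|move=> _ [m _ <-]; exact: uu].
  by rewrite ler_norml; apply/andP; split; lra.
have L01 x : 0 <= L x <= 1.
  apply/andP; split; rewrite leNgt; apply/negP => h.
    have [|n nd] := e0 (- L x); first lra.
    have /andP[u0 _] := I01_itv (u n x).
    have := uL n x; rewrite ler_norml => /andP[]; lra.
  have [|n nd] := e0 (L x - 1); first lra.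
  have /andP[_ u1] := I01_itv (u n x).
  have := uL n x; rewrite ler_norml => /andP[]; lra.
pose l x := clamp (L x).
have lE x : set_val (l x) = L x by exact: val_clamp.
have cl : continuous l.
  apply: (@I01_continuous R (I01 R)) => x.
  apply/(@cvgrPdist_lt R R _ (nbhs x)) => d d0 /=.
  have [|n nd] := e0 (d / 3); first lra.
  have cu : continuous (set_val \o u n : I01 R -> R).
    move=> y; apply: continuous_comp; first exact: Clambda_continuous.
    exact: continuous_val.
  have /(@cvgrPdist_lt R R _ (nbhs x))/(_ (d / 3)) /= := cu x; rewrite divr_gt0// => /(_ isT).
  apply: filterS => y; rewrite !lE.
  have := uL n x; have := uL n y.
  rewrite !ler_norml !ltr_norml => /andP[? ?] /andP[? ?] /andP[? ?].
  by apply/andP; split; lra.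
have pl : preserves_lambda l.
  apply: preserves_lambdaP => // c /andP[c0 c1]; apply/eqP.
  rewrite eq_le; apply/andP; split; apply/lee_addgt0Pr => d d0.
    have [|n nd] := e0 d => //.
    rewrite -EFinD (le_trans _ (lambda_ray_le (u n) _))//; last lra.
    apply: le_lambda => x /=; rewrite lE.
    have := uL n x; rewrite ler_norml => /andP[]; lra.
  have [|n nd] := e0 d => //.
  rewrite -leeBlDr// -EFinB (le_trans (lambda_ray_ge (u n) _))//; first lra.
  apply: le_lambda => x /=; rewrite lE.
  have := uL n x; rewrite ler_norml => /andP[]; lra.
exists (MkClambda cl pl) => n; apply: rho_le => x /=.
by rewrite lE.
Qed.

Lemma Clambda_ballE f d g : ball f d g = (rho f g < d) :> Prop.
Proof. by []. Qed.

(** Nested closed balls, with radii tending to zero. *)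
Lemma Clambda_Baire (F : nat -> set (Clambda R)) :
  (forall n, open (F n) /\ dense (F n)) -> dense (\bigcap_n F n).
Proof.
move=> odF D [a Da] oD.
pose cball (p : Clambda R * {posnum R}) : set (Clambda R) :=
  [set g | rho p.1 g <= p.2%:num].
have shrink (U : set (Clambda R)) b (d : R) : 0 < d -> open U -> U b ->
    exists r : {posnum R}, cball (b, r) `<=` U /\ r%:num <= d.
  move=> d0; rewrite openE => /[apply] /nbhs_ballP[e /= e0 eU].
  have m0 : 0 < Num.min (e / 2) d by rewrite lt_min d0 divr_gt0.
  exists (PosNum m0) => /=; split; last by rewrite ge_min lexx orbT.
  move=> g /= bg; apply: eU; rewrite Clambda_ballE (le_lt_trans bg)//.
  by rewrite gt_min; apply/orP; left; lra.
have [r0 [r0D _]] := shrink D a 1 ltr01 oD Da.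
have step (q : nat * (Clambda R * {posnum R})) : exists p,
    cball p `<=` cball q.2 `&` F q.1 /\ p.2%:num <= q.1.+1%:R^-1.
  case: q => n [b r] /=; have [oF dF] := odF n.
  have [b' [bb' Fb']] : ((ball b r%:num)° `&` F n) !=set0.
    apply: dF; last exact: open_interior.
    by exists b; apply: nbhsx_ballx; exact: gt0.
  have [||r' [r'U r'n]] :=
      shrink ((ball b r%:num)° `&` F n) b' n.+1%:R^-1 _ _ (conj bb' Fb').
  - by rewrite invr_gt0.
  - by apply: openI => //; exact: open_interior.
  exists (b', r'); split => // g /r'U[/interior_subset bg Fg]; split => //.
  exact: ltW.
have [nx nxP] := choice step.
pose p := fix p n := if n is n'.+1 then nx (n', p n') else (a, r0).
have pS n : cball (p n.+1) `<=` cball (p n) `&` F n.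
  by have [] := nxP (n, p n).
have pmono n m : (n <= m)%N -> cball (p m) `<=` cball (p n).
  move=> /subnKC <-; elim: (m - n)%N => [|k IH]; first by rewrite addn0.
  by rewrite addnS => g /pS[/IH].
have pin n : cball (p n) (p n).1 by rewrite /cball/= rhoxx.
have [||l lP] := @Clambda_complete (fun n => (p n).1) (fun n => (p n).2%:num).
- by move=> n m nm; exact: pmono nm _ (pin m).
- move=> d d0; exists (Num.truncn d^-1).+2.
  apply: le_lt_trans (proj2 (nxP (_, p (Num.truncn d^-1).+1))) _ => /=.
  by rewrite invf_plt ?posrE// (lt_trans (truncnS_gt _))// ltr_nat.
exists l; split; first exact/r0D/(lP 0%N).
by move=> n _; have [] := pS n l (lP n.+1).
Qed.

End completeness.

(** * The typical maps *)

Section typical.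
Context {R : realType}.
Implicit Types (x y z : I01 R) (f g h phi : Clambda R) (N k n : nat).

Lemma Clambda_uniform_continuous f (e : R) : 0 < e ->
  exists2 d : R, 0 < d & forall x y, `|set_val x - set_val y| < d ->
    `|set_val (f x) - set_val (f y)| < e.
Proof.
move=> e0; pose F := set_val \o f \o clamp : R -> R.
have cF : continuous F.
  by apply: continuous_real_extension; exact: Clambda_continuous.
pose P (d x : R) := forall t : R, `|x - t| < d -> `|F x - F t| < e.
have : \forall d \near 0^'+, `[0, 1] `<=` P d.
  have /compact_near_coveringP := @segment_compact R 0 1.
  apply => s _.
  have /cvgrPdist_lt/(_ (e / 2)) := cF s; rewrite divr_gt0// => /(_ isT).
  move=> /nbhs_ballP[d /= d0 dF].
  exists (ball s (d / 2), [set r : R | r < d / 2]).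
    split; first by apply: nbhsx_ballx; rewrite divr_gt0.
    by apply: nbhs_right_lt; rewrite divr_gt0.
  move=> [x r] /= [sx rd] t xt.
  have := dF x; have := dF t; rewrite /ball /=.
  have : `|s - x| < d / 2 by move: sx; rewrite -ball_normE.
  move=> sxd /(_ ltac:(rewrite (le_lt_trans (ler_distD x _ _))//; lra)) Ft.
  move=> /(_ ltac:(lra)) Fx.
  rewrite (le_lt_trans (ler_distD (F s) _ _))// (distrC (F x)); lra.
move=> H; have [d [d0 dP]] : exists d : R, 0 < d /\ `[0, 1] `<=` P d.
  near (0 : R)^'+ => d; exists d; split; near: d; last exact: H.
  exact: nbhs_right_gt.
exists d => // x y xy.
have := dP (set_val x) _ (set_val y) xy; rewrite /F /= !clampK; apply.
by rewrite /= in_itv; exact: I01_itv.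
Unshelve. all: by end_near. Qed.

Lemma exists_window x N : (0 < N)%N -> exists2 i, (i < N)%N & window N i x.
Proof.
move=> N0; have N0' : 0 < N%:R :> R by rewrite ltr0n.
have /andP[x0 x1] := I01_itv x.
have [xlt1|x1'] := ltP (set_val x : R) 1; last first.
  exists N.-1; first by rewrite prednK.
  rewrite /window /= (@le_anti _ _ (set_val x : R) 1) ?x1// prednK//.
  by rewrite ler_pdivrMr// mul1r ler_nat leq_pred /= divff// gt_eqF.
have Nx0 : 0 <= set_val x * N%:R :> R by rewrite mulr_ge0.
have := truncn_itv Nx0; set i := Num.truncn _ => /andP[i0 i1].
exists i; last by rewrite /window/= ler_pdivrMr// i0 ler_pdivlMr// ltW.
by rewrite -(ltr_nat R) (le_lt_trans i0)// gtr_pMl.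
Qed.

(** The radius [1 / (3 N)] is less than half the length of a window, which is
    what [length_window_le] asks for in the proof of [straddle_junction]. *)
Definition crumpled n : set (Clambda R) := [set h | exists f phi g N k,
  [/\ (n < N)%N, (n <= k)%N, crumples N k phi, g =1 f \o phi
    & rho g h < (3 * N%:R)^-1]].

Lemma open_crumpled n : open (crumpled n).
Proof.
rewrite openE => h [f [phi [g [N [k [nN nk cphi gE gh]]]]]].
apply/nbhs_ballP; exists ((3 * N%:R)^-1 - rho g h); first by rewrite /= subr_gt0.
move=> h' hh'; exists f, phi, g, N, k; split => //.
rewrite (le_lt_trans (rho_triangle h g h'))//.
by move: hh'; rewrite Clambda_ballE; lra.
Qed.

(** [crumples] keeps every point in its window, so [f \o phi] is as close to [f]
    as its modulus of continuity at [1 / N] tells. *)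
Lemma dense_crumpled n : dense (crumpled n).
Proof.
move=> U [f Uf]; rewrite openE => /(_ f Uf)/nbhs_ballP[e /= e0 eU].
have [d d0 fd] := Clambda_uniform_continuous f (divr_gt0 e0 (ltr0n R 2)).
pose N := (Num.truncn d^-1 + n).+1.
have [phi cphi] := exists_crumples (R:=R) n (ltn0Sn (Num.truncn d^-1 + n)).
have [g gE] := Clambda_comp f phi.
have N0 : 0 < N%:R :> R by rewrite ltr0n.
have Nd : N%:R^-1 < d.
  rewrite invf_plt ?posrE// (lt_le_trans (truncnS_gt _))// ler_nat.
  by rewrite ltnS leq_addr.
exists g; split.
  apply: eU; rewrite Clambda_ballE.
  suff : rho f g <= e / 2 by move=> /le_lt_trans; apply; lra.
  apply: rho_le => x; rewrite gE; apply/ltW/fd; rewrite /=.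
  have [i iN wx] := exists_window x (ltn0Sn _ : (0 < N)%N).
  have [phiW _ _] := cphi; have := phiW i x iN wx.
  move: wx; rewrite /window /= -/N fracS => h1 h2.
  apply: le_lt_trans Nd; rewrite ler_norml; lra.
exists f, phi, g, N, n; split => //; first by rewrite ltnS leq_addl.
by rewrite rhoxx invr_gt0 mulr_gt0.
Qed.

End typical.

(** * Straddling a value on small intervals *)

Section straddling.
Context {R : realType}.
Implicit Types (x y z w : I01 R) (f g h phi : Clambda R) (N k n : nat) (t e : R).

(** A map preserving lambda cannot squeeze a window into a shorter interval: the
    window is contained in the preimage of that interval. *)
Lemma length_window_le f N i t e : (i < N)%N ->
  (forall z, window N i z -> `|set_val (f z) - t| <= e) ->
  N%:R^-1 <= 2 * e.
Proof.
move=> iN fze; have N0 : 0 < N%:R :> R by rewrite ltr0n (leq_ltn_trans _ iN).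
have NV0 : 0 < N%:R^-1 :> R by rewrite invr_gt0.
have e0 : 0 <= e.
  have i01 : 0 <= (i%:R / N%:R : R) <= 1.
    by rewrite divr_ge0//= ler_pdivrMr// mul1r ler_nat ltnW.
  apply: le_trans (fze (clamp (i%:R / N%:R)) _); first exact: normr_ge0.
  by rewrite /window/= val_clamp// fracS; lra.
pose J := `[t - e, t + e]%classic : set R.
have winE : lambda (window N i : set (I01 R)) = (N%:R^-1)%:E.
  rewrite [window N i](_ : _ = set_val @^-1` `[i%:R / N%:R, i.+1%:R / N%:R]).
    rewrite lambda_preimage_val setIidl.
      rewrite lebesgue_measure_itv /= lte_fin fracS ltrDl NV0 -EFinB.
      by congr EFin; lra.
    move=> s; rewrite /= !in_itv /= => /andP[s0 s1]; apply/andP; split.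
      by apply: le_trans s0; rewrite divr_ge0.
    by rewrite (le_trans s1)// ler_pdivrMr// mul1r ler_nat.
  by apply/seteqP; split => z; rewrite /window /= in_itv.
rewrite -lee_fin -winE.
apply: (@le_trans _ _ (lambda (f @^-1` (set_val @^-1` J)))).
  apply: le_lambda => z /fze; rewrite /= /J /= in_itv /= ler_norml; lra.
rewrite -(Clambda_preserves f); last first.
  by apply: borelI01_preimage_val; exact: measurable_itv.
rewrite lambda_preimage_val (@le_trans _ _ (lebesgue_measure J))//.
  by apply: le_outer_measure; exact: subIsetl.
rewrite lebesgue_measure_itv /= lte_fin; case: ifPn => _.
  by rewrite -EFinB lee_fin; lra.
by rewrite lee_fin; lra.
Qed.

(** On the two laps that meet at [j.+1 / N], [phi] runs continuously from the left
    end of window [j] to the right end of window [j.+1]. *)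
Lemma junction_onto N k phi j z : crumples N k phi -> (j.+1 < N)%N ->
  window N j z \/ window N j.+1 z ->
  exists2 w, `|set_val w - j.+1%:R / N%:R| <= lap N k & phi w = z.
Proof.
move=> [_ phiF phiL] jN wz; have N0 : (0 < N)%N by exact: leq_ltn_trans jN.
have N0' : 0 < N%:R :> R by rewrite ltr0n.
have jN' : (j < N)%N by exact: ltnW.
have l0 := @lap_gt0 R N k N0; have l1 := @lap_le R N k N0.
pose F := set_val \o phi \o clamp : R -> R.
have cF : continuous F.
  by apply: continuous_real_extension; exact: Clambda_continuous.
pose p : R := j.+1%:R / N%:R.
have p0 : N%:R^-1 <= p by rewrite /p fracS lerDr divr_ge0.
have p1 : p + N%:R^-1 <= 1.
  by rewrite /p -fracS ler_pdivrMr// mul1r ler_nat.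
have Fa : F (p - lap N k) = j%:R / N%:R.
  by rewrite /F /=; apply: phiL => //; rewrite val_clamp//; lra.
have Fb : F (p + lap N k) = j.+2%:R / N%:R.
  by rewrite /F /=; apply: phiF => //; rewrite val_clamp//; lra.
have [|||s sp Fs] := @IVT R F (p - lap N k) (p + lap N k) (set_val z).
- lra.
- exact: continuous_subspaceT.
- have := @fracS R N j; have := @fracS R N j.+1; rewrite Fa Fb ge_min le_max.
  by case: wz; rewrite /window /=; lra.
move: sp; rewrite in_itv /= => sp.
exists (clamp s); last by apply: val_inj.
by rewrite val_clamp; [rewrite ler_norml -/p; lra|lra].
Qed.

Lemma exists_switch (P Q : nat -> Prop) a b : (a < b)%N ->
  (forall i, (a <= i <= b)%N -> P i \/ Q i) -> P a -> Q b ->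
  exists j, [/\ (a <= j < b)%N, P j & Q j.+1].
Proof.
elim: b => // b IH ab PQ Pa Qb.
have [Pb|nPb] := pselect (P b); first by exists b; rewrite leqnn andbT -ltnS.
have {}ab : (a < b)%N.
  by rewrite ltn_neqAle -ltnS ab andbT; apply/eqP => abE; rewrite abE in Pa.
have [|//||j [/andP[aj jb] Pj Qj]] := IH ab.
- by move=> i /andP[ai ib]; apply: PQ; rewrite ai (leq_trans ib).
- by have [] := PQ b; rewrite ?leqnSn ?andbT// ltnW.
by exists j; split => //; rewrite aj ltnS ltnW.
Qed.

(** Going through the windows from that of [x1] to that of [x2], which is another
    one, the first has a value of [f] below [t - 1 / (3 N)], the last a value
    above [t + 1 / (3 N)], and each has one or the other by [length_window_le].
    So two adjacent windows have values of opposite kinds, and both values occur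
    on the laps meeting at their common end. Passing from [f \o phi] to [h] costs
    less than [1 / (3 N)]. *)
Lemma straddle_junction f g h phi N k x1 x2 t :
  crumples N k phi -> g =1 f \o phi -> rho g h < (3 * N%:R)^-1 ->
  N%:R^-1 < `|set_val x1 - set_val x2| ->
  set_val (h x1) < t - N%:R^-1 -> t + N%:R^-1 < set_val (h x2) ->
  exists j w1 w2, [/\ (j < N)%N,
    Num.min (set_val x1) (set_val x2) <= j%:R / N%:R <=
      Num.max (set_val x1) (set_val x2),
    `|set_val w1 - j%:R / N%:R| <= lap N k,
    `|set_val w2 - j%:R / N%:R| <= lap N k
    & set_val (h w1) < t < set_val (h w2)].
Proof.
move=> cphi gE ghN x12 hx1 hx2.
have [N0|N0] := posnP N.
  have r0 : 0 <= rho g h := le_trans (normr_ge0 _) (rho_ub g h x1).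
  by exfalso; move: ghN; rewrite N0 mulr0 invr0 ltNge r0.
have N0' : 0 < N%:R :> R by rewrite ltr0n.
have NV0 : 0 < N%:R^-1 :> R by rewrite invr_gt0.
set e := N%:R^-1 / 3 : R.
have {ghN}ghe z : `|set_val (f (phi z)) - set_val (h z)| < e.
  rewrite -[f (phi z)]/((f \o phi) z) -gE (le_lt_trans (rho_ub g h z))//.
  by move: ghN; rewrite invfM mulrC.
pose low i := exists2 z, window N i z & set_val (f z) < t - e.
pose high i := exists2 z, window N i z & t + e < set_val (f z).
have low_high i : (i < N)%N -> low i \/ high i.
  move=> iN; apply: contrapT => /not_orP[nl nh].
  have : N%:R^-1 <= 2 * e.
    apply: (@length_window_le f N i t) => // z wz; rewrite ler_norml.
    apply/andP; split; rewrite leNgt; apply/negP => fz.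
      by apply: nl; exists z => //; lra.
    by apply: nh; exists z => //; lra.
  rewrite /e; lra.
have straddle j : (j.+1 < N)%N -> (low j /\ high j.+1) \/ (high j /\ low j.+1) ->
    exists w1 w2, [/\ `|set_val w1 - j.+1%:R / N%:R| <= lap N k,
      `|set_val w2 - j.+1%:R / N%:R| <= lap N k
      & set_val (h w1) < t < set_val (h w2)].
  move=> jN lh; have [z1 [z2 [wz1 wz2 fz1 fz2]]] : exists z1 z2,
      [/\ window N j z1 \/ window N j.+1 z1, window N j z2 \/ window N j.+1 z2,
        set_val (f z1) < t - e & t + e < set_val (f z2)].
    case: lh => -[[u wu fu] [v wv fv]]; [exists u, v|exists v, u];
      by split => //; tauto.
  have [w1 w1j w1E] := junction_onto cphi jN wz1.
  have [w2 w2j w2E] := junction_onto cphi jN wz2.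
  exists w1, w2; split => //.
  have := ghe w1; have := ghe w2; rewrite w1E w2E !ltr_norml.
  by move=> /andP[? ?] /andP[? ?]; apply/andP; split; lra.
have [phiW _ _] := cphi.
have [i1 i1N w1] := exists_window x1 N0.
have [i2 i2N w2] := exists_window x2 N0.
have low1 : low i1.
  exists (phi x1); first exact: phiW.
  by have := ghe x1; rewrite ltr_norml /e => /andP[]; lra.
have high2 : high i2.
  exists (phi x2); first exact: phiW.
  by have := ghe x2; rewrite ltr_norml /e => /andP[]; lra.
have between a b (xa xb : I01 R) j : window N a xa -> window N b xb -> (a <= j < b)%N ->
    (set_val xa : R) <= j.+1%:R / N%:R <= set_val xb.
  move=> /andP[_ xa1] /andP[xb0 _] /andP[aj jb].
  apply/andP; split; first by apply: le_trans xa1 _; exact: ler_frac.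
  exact: le_trans (ler_frac N jb) xb0.
have [i12|i21|i12] := ltngtP i1 i2; last first.
- exfalso; move: x12 w1 w2; rewrite /window /= i12 fracS => + ? ?.
  by rewrite ltNge ler_norml => /negP; apply; lra.
- have [|j [jb Pj Qj]] := @exists_switch high low i2 i1 i21 _ high2 low1.
    by move=> i /andP[_ ii1]; apply/or_comm/low_high/(leq_ltn_trans ii1).
  have jN : (j.+1 < N)%N by case/andP: jb => _ ji; exact: leq_ltn_trans ji i1N.
  have [|v1 [v2 [v1j v2j hv]]] := straddle j jN; first by right.
  exists j.+1, v1, v2; split => //.
  by rewrite ge_min le_max; have /andP[-> ->] := between _ _ _ _ _ w2 w1 jb;
    rewrite !orbT.
have [|j [jb Pj Qj]] := @exists_switch low high i1 i2 i12 _ low1 high2.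
  by move=> i /andP[_ ii1]; apply/low_high/(leq_ltn_trans ii1).
have jN : (j.+1 < N)%N by case/andP: jb => _ ji; exact: leq_ltn_trans ji i2N.
have [|v1 [v2 [v1j v2j hv]]] := straddle j jN; first by left.
exists j.+1, v1, v2; split => //.
by rewrite ge_min le_max; have /andP[-> ->] := between _ _ _ _ _ w1 w2 jb;
  rewrite !orbT.
Qed.

End straddling.

(** * The null set mapped onto the unit interval *)

Section onto.
Context {R : realType}.
Implicit Types (x y z w : I01 R) (f g h phi : Clambda R) (N k n : nat).
Local Notation mu := (@lebesgue_measure R).

(** The radius is twice the length of a lap, so that points on the two laps that
    meet at [j / N] are interior to the joint; this leaves room for the next,
    smaller joint when the construction is iterated. *)
Definition joint N k (j : nat) : set R :=
  `[j%:R / N%:R - 2 * lap N k, j%:R / N%:R + 2 * lap N k]%classic.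

Definition joints N k : set R := \big[setU/set0]_(j < N) joint N k j.

Lemma measurable_joints N k : measurable (joints N k).
Proof. by apply: bigsetU_measurable => j _; exact: measurable_itv. Qed.

Lemma lebesgue_measure_joints N k : (mu (joints N k) <= (4 / 3 ^+ k)%:E)%E.
Proof.
have [->|N0] := posnP N.
  by rewrite /joints big_ord0 measure0 lee_fin divr_ge0// exprn_ge0.
have l0 := @lap_gt0 R N k N0.
apply: le_trans (Boole_inequality mu (A := joint N k) _) _.
  by move=> j _; exact: measurable_itv.
rewrite (eq_bigr (fun=> (4 * lap N k)%:E)) => [|j _]; last first.
  apply: (etrans (lebesgue_measure_itv _)); rewrite /= lte_fin ifT; last lra.
  by rewrite -EFinB; congr EFin; lra.
rewrite sumEFin lee_fin sumr_const card_ord -[leLHS]mulr_natl /lap.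
have N0' : N%:R != 0 :> R by rewrite pnatr_eq0 -lt0n.
by rewrite invfM mulrCA mulrA mulrA -(mulrA 4) mulfV// mulr1.
Qed.

(** The preimage of an interval of positive length has positive measure, hence is
    not empty. *)
Lemma Clambda_below h (e : R) : 0 < e -> exists x, set_val (h x) < e.
Proof.
move=> e0; apply: contrapT => /forallNP hx.
have m0 : 0 < Num.min e 1 by rewrite lt_min e0 ltr01.
have := @lambda_ray_Clambda _ h (Num.min e 1).
rewrite ge_min lexx orbT ltW//= => /(_ isT).
rewrite [X in lambda X](_ : _ = set0).
  by rewrite /lambda image_set0 measure0 => -[] /esym/eqP; rewrite gt_eqF.
by rewrite -subset0 => x /=; rewrite lt_min => /andP[/hx].
Qed.

Lemma Clambda_above h (e : R) : e < 1 -> exists x, e < set_val (h x).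
Proof.
move=> e1; apply: contrapT => /forallNP hx.
pose c := (Num.max e 0 + 1) / 2.
have [ec c0 c1] : [/\ e < c, 0 <= c & c < 1].
  by rewrite /c; have [] := leP e 0; split; lra.
have := @lambda_ray_Clambda _ h c; rewrite c0 ltW// => /(_ isT).
rewrite [X in lambda X](_ : _ = setT).
  by rewrite lambda_setT => -[]; lra.
rewrite -subTset => x _ /=; rewrite (le_lt_trans _ ec)// leNgt.
by apply/negP/hx.
Qed.

(** The extreme values are attained by compactness, and the two lemmas above
    identify them. *)
Lemma Clambda_ends h : (exists x, set_val (h x) = 0 :> R) /\
  (exists x, set_val (h x) = 1 :> R).
Proof.
pose F := set_val \o h \o clamp : R -> R.
have cF : {within `[0, 1], continuous F}.
  apply: continuous_subspaceT.
  by apply: continuous_real_extension; exact: Clambda_continuous.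
have in01 x : (set_val x : R) \in `[0, 1] by rewrite in_itv; exact: I01_itv.
split.
  have [s _ smin] := EVT_min ler01 cF; exists (clamp s).
  have /andP[s0 _] := I01_itv (h (clamp s)).
  apply/eqP; rewrite eq_le s0 andbT leNgt; apply/negP => /(Clambda_below h)[x hx].
  by have := smin _ (in01 x); rewrite /F /= clampK leNgt hx.
have [s _ smax] := EVT_max ler01 cF; exists (clamp s).
have /andP[_ s1] := I01_itv (h (clamp s)).
apply/eqP; rewrite eq_le s1 /= leNgt; apply/negP => /(Clambda_above h)[x hx].
by have := smax _ (in01 x); rewrite /F /= clampK leNgt hx.
Qed.

(** The witnesses are interior points of the interval with ends [J.1] and [J.2],
    so that small joints centred between them lie inside that interval. *)
Definition straddles h (t : R) (J : R * R) := exists x1 x2,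
  [/\ J.1 < set_val x1 < J.2, J.1 < set_val x2 < J.2
    & set_val (h x1) < t < set_val (h x2)].

(** At a level [m] where [1 / N] is small compared with the margins of the given
    straddling points, [straddle_junction] applies and the joint it yields stays
    inside the interval. *)
Lemma straddles_refine h (N k : nat -> nat) (t : R) (J : R * R) n :
  (forall m, [/\ (m < N m)%N, (m <= k m)%N & exists f phi g,
     [/\ crumples (N m) (k m) phi, g =1 f \o phi
       & rho g h < (3 * (N m)%:R)^-1]]) ->
  straddles h t J ->
  exists J' : R * R, [/\ straddles h t J', J.1 <= J'.1, J'.2 <= J.2,
    J'.2 - J'.1 <= 4 / n.+1%:R
    & exists2 m, (n <= m)%N & `[J'.1, J'.2]%classic `<=` joints (N m) (k m)].
Proof.
move=> NkP [x1 [x2 [x1J x2J /andP[hx1 hx2]]]].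
have x12 : (set_val x1 : R) != set_val x2.
  by apply: contraTneq hx2 => /val_inj <-; rewrite -leNgt ltW.
pose e := Num.min (Num.min (t - set_val (h x1)) (set_val (h x2) - t))
  (Num.min `|set_val x1 - set_val x2|
    (Num.min (Num.min (set_val x1) (set_val x2) - J.1)
      (J.2 - Num.max (set_val x1) (set_val x2)) / 2)) : R.
have e0 : 0 < e.
  rewrite /e !lt_min !subr_gt0 hx1 hx2 normr_gt0 subr_eq0 x12 /=.
  rewrite divr_gt0// lt_min !subr_gt0 lt_min gt_max.
  by move: x1J x2J => /andP[-> ->] /andP[-> ->].
pose m := (Num.truncn e^-1 + n)%N.
have [mN mk [f [phi [g [cphi gE gh]]]]] := NkP m.
have N0 : (0 < N m)%N by exact: leq_ltn_trans mN.
have N0' : 0 < (N m)%:R :> R by rewrite ltr0n.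
have Ne : (N m)%:R^-1 < e.
  rewrite invf_plt ?posrE// (lt_le_trans (truncnS_gt _))// ler_nat.
  by rewrite (leq_trans _ mN)// ltnS leq_addr.
have Nn : (N m)%:R^-1 <= n.+1%:R^-1 :> R.
  by rewrite lef_pV2 ?posrE ?ltr0n// ler_nat (leq_trans _ mN)// ltnS leq_addl.
move: Ne; rewrite /e !lt_min => /andP[/andP[Ne1 Ne2] /andP[Ne3 Ne4]].
move: Ne4; rewrite ltr_pdivlMr// lt_min => /andP[Ne4 Ne5].
have [||j [w1 [w2 [jN /andP[jl jr] w1j w2j hw]]]] :=
  straddle_junction (t := t) cphi gE gh Ne3.
- by rewrite ltrBrDl addrC -ltrBrDl.
- by rewrite -ltrBrDl.
have {Ne4}jJ1 : J.1 + (N m)%:R^-1 * 2 < j%:R / (N m)%:R.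
  by rewrite (lt_le_trans _ jl)// -ltrBrDl.
have {Ne5}jJ2 : j%:R / (N m)%:R + (N m)%:R^-1 * 2 < J.2.
  by rewrite -ltrBrDr (le_lt_trans jr)// ltrBrDr -ltrBrDl.
have l0 := @lap_gt0 R _ (k m) N0; have l1 := @lap_le R _ (k m) N0.
exists (j%:R / (N m)%:R - 2 * lap (N m) (k m),
        j%:R / (N m)%:R + 2 * lap (N m) (k m)); split => /=.
- exists w1, w2; split => //=.
    by move: w1j; rewrite ler_norml; lra.
  by move: w2j; rewrite ler_norml; lra.
- lra.
- lra.
- have -> : forall a b : R, a + b - (a - b) = 2 * b by move=> a b; lra.
  by rewrite mulrA -natrM ler_pM2l// (le_trans l1).
- exists m; first exact: leq_addl.
  exact: (bigsetU_sup (F := joint (N m) (k m)) jN).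
Qed.

(** Arbitrarily close to the common point [x] of the intervals, [h] has values
    below [t] and values above [t]; by continuity [h x = t]. *)
Lemma nested_straddles h (t : R) (J : nat -> R * R) :
  (forall n, straddles h t (J n)) ->
  (forall n, (J n).1 <= (J n.+1).1 /\ (J n.+1).2 <= (J n).2) ->
  (forall n, (J n.+1).2 - (J n.+1).1 <= 4 / n.+1%:R) ->
  exists x, set_val (h x) = t /\
    forall n, (J n).1 <= (set_val x : R) <= (J n).2.
Proof.
move=> Js Jmono Jlen.
have mono1 n m : (n <= m)%N -> (J n).1 <= (J m).1.
  move=> /subnKC <-; elim: (m - n)%N => [|i IH]; first by rewrite addn0.
  by rewrite addnS (le_trans IH)//; have [] := Jmono (n + i)%N.
have mono2 n m : (n <= m)%N -> (J m).2 <= (J n).2.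
  move=> /subnKC <-; elim: (m - n)%N => [|i IH]; first by rewrite addn0.
  by rewrite addnS (le_trans _ IH)//; have [] := Jmono (n + i)%N.
have J12 n : (J n).1 <= (J n).2.
  by have [x1 [_ [/andP[a b] _ _]]] := Js n; rewrite ltW// (lt_trans a).
have J12' n m : (J n).1 <= (J m).2.
  have [nm|mn] := leqP n m.
    exact: le_trans (mono1 _ _ nm) (J12 m).
  exact: le_trans (J12 n) (mono2 _ _ (ltnW mn)).
pose A := [set (J n).1 | n in [set: nat]].
have supA : has_sup A.
  split; first by exists (J 0%N).1, 0%N.
  by exists (J 0%N).2 => _ [n _ <-]; exact: J12'.
pose s := sup A.
have sJ n : (J n).1 <= s <= (J n).2.
  apply/andP; split; first by apply: ub_le_sup; [exact: supA.2|exists n].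
  by apply: ge_sup; [exact: supA.1|move=> _ [m _ <-]; exact: J12'].
have short (d : R) : 0 < d -> exists n, (J n).2 - (J n).1 < d.
  move=> d0; pose n := Num.truncn (4 / d); exists n.+1.
  apply: le_lt_trans (Jlen n) _.
  by rewrite ltr_pdivrMr// mulrC -ltr_pdivrMr// truncnS_gt.
have s01 : 0 <= s <= 1.
  apply/andP; split; rewrite leNgt; apply/negP => s0.
    have [|n Jn] := short (- s); first by rewrite oppr_gt0.
    have [x1 [_ [/andP[_ x1J] _ _]]] := Js n.
    by have /andP[x10 _] := I01_itv x1; have := sJ n; lra.
  have [|n Jn] := short (s - 1); first by rewrite subr_gt0.
  have [x1 [_ [/andP[x1J _] _ _]]] := Js n.
  by have /andP[_ x11] := I01_itv x1; have := sJ n; lra.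
exists (clamp s); rewrite val_clamp//; split => //.
have close (e : R) : 0 < e -> exists x1 x2,
    [/\ `|set_val (h x1) - set_val (h (clamp s))| < e,
      `|set_val (h x2) - set_val (h (clamp s))| < e
      & set_val (h x1) < t < set_val (h x2)].
  move=> /(Clambda_uniform_continuous h)[d d0 hd].
  have [n Jn] := short d d0; have [x1 [x2 [x1J x2J hx]]] := Js n.
  exists x1, x2; split => //; apply: hd; rewrite val_clamp//;
    have := sJ n; rewrite ltr_norml; lra.
apply/eqP; rewrite eq_le; apply/andP; split; rewrite leNgt; apply/negP => ht.
  have [|x1 [x2 [h1 h2 hx]]] := close (set_val (h (clamp s)) - t); first lra.
  by move: h1; rewrite ltr_norml; lra.
have [|x1 [x2 [h1 h2 hx]]] := close (t - set_val (h (clamp s))); first lra.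
by move: h2; rewrite ltr_norml; lra.
Qed.

(** The superior limit of the sets [joints] is null by Borel-Cantelli. It meets the
    fibre of every [t] strictly between [0] and [1], since the common point of
    the nested intervals lies in joints of infinitely many levels. *)
Lemma crumpled_null_onto h : (forall n, crumpled n h) ->
  exists Z : set (I01 R), lambda Z = 0%E /\ h @` Z = [set: I01 R].
Proof.
move=> hc; have /choice[p pP] : forall m, exists p : nat * nat,
    [/\ (m < p.1)%N, (m <= p.2)%N & exists f phi g,
     [/\ crumples p.1 p.2 phi, g =1 f \o phi & rho g h < (3 * p.1%:R)^-1]].
  move=> m; have [f [phi [g [N [k [mN mk cphi gE gh]]]]]] := hc m.
  by exists (N, k); split => //; exists f, phi, g.
pose L m := joints (p m).1 (p m).2.
have L0 : mu (lim_sup_set L) = 0.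
  apply: lim_sup_set_cvg0 => [m|]; first exact: measurable_joints.
  (* [4 / 3 ^ m <= 4 / 2 ^ m = 8 / 2 ^ m.+1] is the general term of a series
     bounded by [epsilon_trick0]. *)
  apply: (@le_lt_trans _ _ (\sum_(0 <= m <oo) (8 / (2 ^ m.+1)%:R)%:E)%E).
    apply: lee_nneseries => // m _; apply: le_trans (lebesgue_measure_joints _ _) _.
    have [_ mk _] := pP m; rewrite lee_fin expnS natrM natrX invfM.
    have -> : 8 * (2^-1 * (2 ^+ m)^-1) = 4 / 2 ^+ m :> R.
      by rewrite mulrA; congr (_ / _); lra.
    rewrite ler_pM2l// lef_pV2 ?posrE ?exprn_gt0//.
    apply: (@le_trans _ _ (3 ^+ m)); first by rewrite lerXn2r ?nnegrE ?ler_nat.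
    by rewrite ler_eXn2l// ltr1n.
  by apply: le_lt_trans (epsilon_trick0 xpredT _) _ => //; rewrite ltry.
have mL : measurable (lim_sup_set L).
  apply: bigcapT_measurable => n; apply: bigcup_measurable => m _.
  exact: measurable_joints.
have [[u0 hu0] [u1 hu1]] := Clambda_ends h.
pose Z := [set x : I01 R | lim_sup_set L (set_val x)] `|` ([set u0] `|` [set u1]).
exists Z; split.
  apply/lambda_eq0.
  apply: (@negligibleS _ _ _ mu (lim_sup_set L `|`
    ([set set_val u0] `|` [set set_val u1]))).
    by move=> _ [x [Lx|[->|->]] <-]; [left|right; left|right; right].
  apply: negligibleU; first exact/negligibleP.
  by apply: negligibleU; apply/negligibleP => //; exact: lebesgue_measure_set1.
rewrite -subTset => y _.
have /andP[y0 y1] := I01_itv y.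
move: y0; rewrite le_eqVlt => /orP[/eqP y0|y0].
  by exists u0; [right; left|apply: val_inj; exact: etrans hu0 y0].
move: y1; rewrite le_eqVlt => /orP[/eqP y1|y1].
  by exists u1; [right; right|apply: val_inj; exact: etrans hu1 (esym y1)].
pose t : R := set_val y.
have step (q : nat * (R * R)) : exists J, straddles h t q.2 ->
    [/\ straddles h t J, q.2.1 <= J.1, J.2 <= q.2.2,
      J.2 - J.1 <= 4 / q.1.+1%:R
      & exists2 m, (q.1 <= m)%N & `[J.1, J.2]%classic `<=` L m].
  have [qs|nqs] := pselect (straddles h t q.2); last by exists q.2.
  have [J Jq] := @straddles_refine h (fst \o p) (snd \o p) t q.2 q.1 pP qs.
  by exists J.
have [nx nxP] := choice step.
pose J := fix J n : R * R := if n is n'.+1 then nx (n', J n') else (-1, 2).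
have Js n : straddles h t (J n).
  elim: n => [|n IH] /=; last by have [] := nxP (n, J n) IH.
  have [x1 h1] := Clambda_below h y0; have [x2 h2] := Clambda_above h y1.
  exists x1, x2; split; rewrite /= ?h1//.
    by have := I01_itv x1; lra.
  by have := I01_itv x2; lra.
have JP n := nxP (n, J n) (Js n).
have [||x [hx xJ]] := @nested_straddles h t J Js.
- by move=> n; have [] := JP n.
- by move=> n; have [] := JP n.
(* The interval [J n.+1] is contained in a joint of level at least [n]. *)
exists x; last exact: val_inj.
left => n _; have [_ _ _ _ [m nm JL]] := JP n.
by exists m => //; apply: JL; rewrite /= in_itv; exact: (xJ n.+1).
Qed.

End onto.

Theorem corollary22 (R : realType) :
  exists G : set (Clambda R),
    [/\ Gdelta G, dense G &
      forall f, G f ->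
        exists Z : set (I01 R), lambda Z = 0%E /\ f @` Z = [set: I01 R]].
Proof.
exists (\bigcap_n crumpled n); split.
- by exists crumpled => // n; exact: open_crumpled.
- by apply: Clambda_Baire => n; split; [exact: open_crumpled|exact: dense_crumpled].
- by move=> h hc; apply: crumpled_null_onto => n; exact: hc.
Qed.
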